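(* Let $n\ge2$ and let $M=([2n],B)$ be an $S_{2n}$-matroid (ordinary matroid) of rank $2$ with thin Schubert cell $G_M\subset G(2,2n)$. If $G_M\cap\mathcal H\ne\emptyset$, then there is a surjective map $\pi:\mathcal G_{M,\mathcal H}\to\mathcal G_M$ whose fiber at $[x]\in\mathcal G_M$ is $(T'x\cap\mathcal H)/T_M$.
   Context: Work over $\mathbb C$, $n\ge2$. For $1\le i\le 2n$ put $i^*=2n+1-i$. $G(2,2n)\subset\mathbb P^N$, $N=\binom{2n}{2}-1$, is the Grassmannian of $2$-planes in $\mathbb C^{2n}$ with Plücker coordinates $[x_{i,j}]$, and $\mathcal H=\{\sum_{i=1}^n x_{i,i^*}=0\}\subset\mathbb P^N$; $G(2,2n)\cap\mathcal H=\mathrm{SpG}(2,2n)$ is the symplectic Grassmannian of isotropic $2$-planes. $T'=(\mathbb C^* )^{2n}$ is the torus of invertible diagonal matrices acting by $\mathrm{diag}(\lambda_i)\cdot[x_{i,j}]=[\lambda_i\lambda_jx_{i,j}]$, and $T\subset T'$ is the subtorus of matrices $\mathrm{diag}(\mu_1,\dots,\mu_n,\mu_n^{-1},\dots,\mu_1^{-1})$. For a rank $2$ matroid $M=([2n],B)$, $G_M=\{x\in G(2,2n): \{\{i,j\}:x_{i,j}\ne0\}=B\}$. The stabilizer in $T'$ of a point of $G_M$ depends only on $M$, denoted $\mathrm{Stab}_{T'}(M)$; put $\mathrm{Stab}_T(M)=\mathrm{Stab}_{T'}(M)\cap T$, $T'_M=T'/\mathrm{Stab}_{T'}(M)$, $T_M=T/\mathrm{Stab}_T(M)$,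 $\mathcal G_M=G_M/T'_M$ (points $[x]$ are $T'$-orbits of $x\in G_M$), and $\mathcal G_{M,\mathcal H}=(G_M\cap\mathcal H)/T_M$ (categorical quotient by the free action of $T_M$). *)

(* Defs.v *)
From mathcomp Require Import all_boot all_order all_algebra.
From mathcomp Require Import mpoly.
From mathcomp Require Import boolp classical_sets functions reals complex.

Set Implicit Arguments.
Unset Strict Implicit.
Unset Printing Implicit Defensive.

Import GRing.Theory.
Local Open Scope ring_scope.
Local Open Scope classical_set_scope.

Record matroid (E : finType) := Matroid {
  bases : {set {set E}};
  bases_neq0 : bases != finset.set0;
  bases_exchange : forall A B : {set E}, A \in bases -> B \in bases ->
    forall a, a \in A :\: B ->
    exists2 b, b \in B :\: A & (b |: (A :\ a))%SET \in bases }.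

Definition has_rank (E : finType) (M : matroid E) (r : nat) : Prop :=
  forall A : {set E}, A \in bases M -> #|A| = r.

(** Spaces with functions: a set of points (inside an ambient type), its open
    subsets and, for each open subset [U], the functions regular on [U]; a
    function in [isreg U] matters only through its values on [U]. Varieties
    are regarded as such spaces, and so are their quotients by groups. *)
Record funspace (F P : Type) := FunSpace {
  pts : set P;
  isopen : set (set P);
  isreg : set P -> set (P -> F) }.

Definition space_morphism F P P' (S : funspace F P) (S' : funspace F P')
    (phi : P -> P') : Prop :=
  [/\ set_fun (pts S) (pts S') phi,
      forall U, isopen S' U -> isopen S (pts S `&` phi @^-1` U)
    & forall U f, isopen S' U -> isreg S' U f ->
        isreg S (pts S `&` phi @^-1` U) (f \o phi)].

(** [orb x] is the orbit of [x]. The points of the quotient are the orbits, a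
    set of orbits is open when their union is, and the regular functions are
    the invariant regular functions. For the varieties below it has the
    universal property of a categorical quotient, see
    [quotient_universal]. *)
Definition space_quotient F P (S : funspace F P) (orb : P -> set P) :
    funspace F (set P) := {|
  pts := orb @` pts S;
  isopen := [set W | W `<=` orb @` pts S /\
                     isopen S (pts S `&` orb @^-1` W)];
  isreg := fun W => [set f : set P -> F |
                      isreg S (pts S `&` orb @^-1` W) (f \o orb)] |}.

Section Projective.
Variables (F : fieldType) (m : nat).

(** Points of projective space are lines in [F^m]; [hcoord x] is a choice of
    homogeneous coordinates of [x]. *)
Definition projspace : set {vspace 'rV[F]_m} := [set x | \dim x = 1%N].

Definition hcoord (x : {vspace 'rV[F]_m}) : 'I_m -> F := (vpick x) ord0.

(** Zariski open subsets of a subset [X] of projective space. *)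
Definition zopen (X : set {vspace 'rV[F]_m}) : set (set {vspace 'rV[F]_m}) :=
  [set U | exists S : set {mpoly F[m]},
     (forall f, S f -> exists d : nat, f \is d.-homog) /\
     U = X `&` [set x | exists2 f, S f & f.@[hcoord x] != 0]].

Definition zregular (X U : set {vspace 'rV[F]_m}) :
    set ({vspace 'rV[F]_m} -> F) :=
  [set f | forall x, U x -> exists V : set {vspace 'rV[F]_m},
     [/\ zopen X V, V `<=` U, V x &
      exists (d : nat) (p q : {mpoly F[m]}),
        [/\ p \is d.-homog, q \is d.-homog &
         forall y, V y -> q.@[hcoord y] != 0 /\
                          f y = p.@[hcoord y] / q.@[hcoord y]]]].

Definition variety (X : set {vspace 'rV[F]_m}) :
    funspace F {vspace 'rV[F]_m} :=
  {| pts := X; isopen := zopen X; isreg := zregular X |}.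

Lemma zregular_ext X U f g :
  (forall x, U x -> f x = g x) -> zregular X U f -> zregular X U g.
Proof.
move=> fg rf x Ux; have [V [oV VU Vx [d [p [q [hp hq pq]]]]]] := rf x Ux.
exists V; split=> //; exists d, p, q; split=> // y Vy.
by rewrite -fg; [exact: pq | exact: VU].
Qed.

Lemma quotient_universal (X : set {vspace 'rV[F]_m})
    (orb : {vspace 'rV[F]_m} -> set {vspace 'rV[F]_m})
    (P : Type) (S : funspace F P) (phi : {vspace 'rV[F]_m} -> P) :
    (forall U, isopen S U -> U `<=` pts S) ->
    (forall x y, X x -> X y -> orb x = orb y -> phi x = phi y) ->
    space_morphism (variety X) S phi ->
  exists psi, [/\ space_morphism (space_quotient (variety X) orb) S psi,
    forall x, X x -> psi (orb x) = phi x &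
    forall psi', (forall x, X x -> psi' (orb x) = phi x) ->
      {in orb @` X, psi =1 psi'}].
Proof.
move=> oS phiK [phiS phio phir].
pose psi O := phi (xget 0%VS [set x | X x /\ orb x = O]).
have psiE x : X x -> psi (orb x) = phi x.
  move=> Xx; rewrite /psi; case: xgetP => [y _ [Xy yx]|/(_ x)]; last by case.
  exact: phiK.
have preE U : X `&` orb @^-1` (orb @` X `&` psi @^-1` U) = X `&` phi @^-1` U.
  apply/seteqP; split=> x [Xx] /= => [[_]|Ux]; first by rewrite psiE.
  by do 2?split=> //; [exists x | rewrite psiE].
exists psi; split=> // [|psi' psi'E O].
  split=> [O [x Xx <-]|U oU|U f oU rf] /=.
  - by rewrite psiE //; apply: phiS.
  - by split=> [O []//|]; rewrite preE; apply: phio.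
  - rewrite preE; apply: zregular_ext (phir U f oU rf) => x [Xx _] /=.
    by rewrite psiE.
by rewrite inE => -[x Xx <-]; rewrite psiE ?psi'E.
Qed.

End Projective.

Section Grassmannian.
Variables (F : fieldType) (n : nat).

(** The indices of the Plücker coordinates [x_{i,j}], [i < j]; indices in
    [1..2n] are shifted down by one, so that [i^*] is [rev_ord i]. *)
Definition plpair := {p : 'I_(2 * n) * 'I_(2 * n) | (p.1 < p.2)%N}.

Local Notation m := #|{: plpair}|.
Local Notation point := {vspace 'rV[F]_m}.

Definition plcoord (x : point) (p : plpair) : F := hcoord x (enum_rank p).

Definition pluecker (A : 'M[F]_(2, 2 * n)) : 'rV[F]_m :=
  \row_k let: (i, j) := val (enum_val k) in
         A ord0 i * A ord_max j - A ord0 j * A ord_max i.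

(** The plane attached to a [2 x 2n] matrix of rank 2 is its row space. *)
Definition grassmannian : set point :=
  [set x | exists2 A : 'M[F]_(2, 2 * n), \rank A = 2%N &
           x = <[pluecker A]>%VS].

Definition hyperplane : set point :=
  @projspace F m `&` [set x | \sum_(p : plpair | (val p).2 == rev_ord (val p).1)
                                plcoord x p = 0].

Definition torus' : set 'M[F]_(2 * n) :=
  [set D | is_diag_mx D /\ D \in unitmx].

Definition torus : set 'M[F]_(2 * n) :=
  torus' `&` [set D | forall i, D (rev_ord i) (rev_ord i) = (D i i)^-1].

Definition weight (D : 'M[F]_(2 * n)) : 'rV[F]_m :=
  \row_k let: (i, j) := val (enum_val k) in D i i * D j j.

Definition tact (D : 'M[F]_(2 * n)) (x : point) : point :=
  (linfun (mulmxr (diag_mx (weight D))) @: x)%VS.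

Section Cell.
Variable M : matroid 'I_(2 * n).

Definition thin_cell : set point :=
  grassmannian `&`
  [set x | [set [set (val p).1; (val p).2]%SET | p : plpair & plcoord x p != 0]%SET
           = bases M].

Definition stab' : set 'M[F]_(2 * n) :=
  torus' `&` [set D | forall x, thin_cell x -> tact D x = x].

Definition stab : set 'M[F]_(2 * n) := stab' `&` torus.

(** The quotient groups [T'_M] and [T_M], as sets of cosets. *)
Definition qtorus' : set (set 'M[F]_(2 * n)) :=
  [set [set D *m E | E in stab'] | D in torus'].

Definition qtorus : set (set 'M[F]_(2 * n)) :=
  [set [set D *m E | E in stab] | D in torus].

(** A coset acts on the thin cell through any of its elements. *)
Definition torus_orbit (Q : set (set 'M[F]_(2 * n))) (x : point) : set point :=
  [set y | exists2 c, Q c & exists2 D, c D & y = tact D x].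

Definition cell_quotient : funspace F (set point) :=
  space_quotient (variety thin_cell) (torus_orbit qtorus').

Definition cell_hyp_quotient : funspace F (set point) :=
  space_quotient (variety (thin_cell `&` hyperplane)) (torus_orbit qtorus).

End Cell.

Lemma torus'E D : torus' D <-> exists2 d : 'rV[F]_(2 * n),
  D = diag_mx d & forall i, d ord0 i != 0.
Proof.
split=> [[/diag_mxP [d ->]]|[d -> d0]].
  rewrite unitmxE det_diag unitfE => /prodf_neq0 d0; exists d => // i.
  by rewrite d0.
split; first exact: diag_mx_is_diag.
by rewrite unitmxE det_diag unitfE; apply/prodf_neq0.
Qed.

Lemma tact_line D v : tact D <[v]>%VS = <[v *m diag_mx (weight D)]>%VS.
Proof. by rewrite /tact limg_line lfunE. Qed.

Lemma tactM D E x : torus' D -> torus' E ->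
  tact (D *m E) x = tact D (tact E x).
Proof.
move=> /torus'E [d -> _] /torus'E [e -> _]; rewrite /tact -limg_comp.
congr (_ @: _)%VS; apply/lfunP => v; rewrite comp_lfunE !lfunE /= -mulmxA.
congr (_ *m _); rewrite !mulmx_diag; congr diag_mx; apply/rowP=> k.
rewrite !mxE; case: (val (enum_val k)) => i j; rewrite !mxE !eqxx !mulr1n.
by rewrite mulrACA mulrC.
Qed.

Lemma tact1 x : tact 1%:M x = x.
Proof.
have w1 : weight 1%:M = const_mx 1.
  apply/rowP=> k; rewrite !mxE; case: (val (enum_val k)) => i j.
  by rewrite !mxE !eqxx mulr1.
rewrite /tact (_ : linfun _ = \1%VF) ?lim1g //; apply/lfunP => v.
by rewrite id_lfunE lfunE /= w1 diag_const_mx mulmx1.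
Qed.

Lemma torus'M D E : torus' D -> torus' E -> torus' (D *m E).
Proof.
move=> /torus'E [d -> d0] /torus'E [e -> e0]; apply/torus'E.
rewrite mulmx_diag; eexists; first by reflexivity.
by move=> i; rewrite mxE mulf_neq0.
Qed.

Lemma torus'1 : torus' 1%:M.
Proof. by split; rewrite ?unitmx1 ?scalar_mx_is_diag. Qed.

Lemma torus1 : torus 1%:M.
Proof. by split; [exact: torus'1 | move=> i; rewrite !mxE !eqxx invr1]. Qed.

Lemma torusM D E : torus D -> torus E -> torus (D *m E).
Proof.
move=> [D' hD] [E' hE]; split; first exact: torus'M.
have [[d dE _] [e eE _]] := ((torus'E D).1 D', (torus'E E).1 E').
move=> i; have := hD i; have := hE i; rewrite dE eE mulmx_diag !mxE !eqxx !mulr1n.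
by move=> -> ->; rewrite invfM.
Qed.

(** The stabilizer of a point of the thin cell depends only on the matroid. *)
Lemma stab'_point M D x : torus' D -> thin_cell M x ->
  tact D x = x -> stab' M D.
Proof.
have fixP y : (exists v : 'rV[F]_m, y = <[v]>%VS) -> torus' D ->
    tact D y = y <-> exists2 c, c != 0 &
      forall p, plcoord y p != 0 -> weight D ord0 (enum_rank p) = c.
  move=> [v yv] D'; have yE : y = <[vpick y]>%VS.
    apply/eqP; rewrite eq_sym eqEdim; apply/andP; split.
      by rewrite -memvE memv_pick.
    rewrite yv !dim_vline vpick0 -yv yv.
    by rewrite -dimv_eq0 dim_vline; case: (v == 0).
  set w := vpick y in yE; split=> [|[c c0 hc]].
    have [w0 _|w0] := eqVneq w 0.
      exists 1; rewrite ?oner_eq0 // => p.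
      by rewrite /plcoord /hcoord -/w w0 mxE eqxx.
    rewrite yE tact_line => ty.
    have: w *m diag_mx (weight D) \in <[w]>%VS by rewrite -ty memv_line.
    case/vlineP => c cE; exists c.
      apply: contraNneq w0 => c0; move: ty; rewrite cE c0 scale0r => ty.
      by have := memv_line w; rewrite -ty; case/vlineP=> ? ->; rewrite scaler0.
    move=> p; rewrite /plcoord /hcoord -/w => wp.
    have /rowP /(_ (enum_rank p)) := cE; rewrite mul_mx_diag !mxE => h.
    by rewrite -yE in wp *; apply: (mulfI wp); rewrite h mulrC.
  rewrite {1}yE tact_line (_ : w *m _ = c *: w).
    rewrite [RHS]yE; apply/eqP; rewrite eqEsubv -!memvE memvZ ?memv_line //=.
    by rewrite -{1}[w](scalerK c0) memvZ ?memv_line.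
  apply/rowP=> k; rewrite mul_mx_diag !mxE mulrC.
  have [->|wk] := eqVneq (w ord0 k) 0; first by rewrite !mulr0.
  by have := hc (enum_val k); rewrite /plcoord /hcoord -/w enum_valK !mxE => ->.
have lineP y : thin_cell M y -> exists v : 'rV[F]_m, y = <[v]>%VS.
  by move=> [[A _ ->] _]; eexists.
move=> D' Mx /(fixP x (lineP x Mx) D') [c c0 hc]; split=> // y My.
apply/(fixP y (lineP y My) D'); exists c => // p yp; apply: hc.
have [[_ Bx] [_ By]] := (Mx, My).
have : [set (val p).1; (val p).2]%SET \in bases M.
  by rewrite -By; apply/imsetP; exists p; rewrite ?inE.
rewrite -Bx => /imsetP [q xq pq]; rewrite inE in xq.
suff -> : p = q by [].
apply: val_inj; move: pq; case: p q {yp xq} => [[i j] /= ij] [[k l] /= kl] /setP e.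
have := (e i, e j); rewrite !inE !eqxx /= orbT => -[].
move=> /esym/orP [] /eqP ? /esym/orP [] /eqP ?; subst=> //;
  rewrite ?ltnn // in ij kl *.
by have := ltn_trans ij kl; rewrite ltnn.
Qed.

(** The actions of [T'_M] and [T_M] are well defined and free, and have the
    same orbits as those of [T'] and [T]. *)
Lemma coset_act M D E x : torus' D -> thin_cell M x -> stab' M E ->
  tact (D *m E) x = tact D x.
Proof. by move=> D' Mx [E' hE]; rewrite tactM // hE. Qed.

Lemma stab_point M D x : torus D -> thin_cell M x ->
  tact D x = x -> stab M D.
Proof. by move=> tD Mx Dx; split=> //; apply: stab'_point Dx => //; case: tD. Qed.

Lemma orbit_qtorus' M x : torus_orbit (qtorus' M) x = [set tact D x | D in torus'].
Proof.
apply/seteqP; split=> y.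
  by move=> [_ [D D' <-] [_ [E [E' _] <-] ->]]; exists (D *m E) => //; apply: torus'M.
move=> [D D' <-]; exists [set D *m E | E in stab' M]; first by exists D.
exists D => //; exists 1%:M; last exact: mulmx1.
by split=> [|z _]; [exact: torus'1 | exact: tact1].
Qed.

Lemma orbit_qtorus M x : torus_orbit (qtorus M) x = [set tact D x | D in torus].
Proof.
apply/seteqP; split=> y.
  by move=> [_ [D D' <-] [_ [E [_ E'] <-] ->]]; exists (D *m E) => //; apply: torusM.
move=> [D D' <-]; exists [set D *m E | E in stab M]; first by exists D.
exists D => //; exists 1%:M; last exact: mulmx1.
split; last exact: torus1.
by split=> [|z _]; [exact: torus'1 | exact: tact1].
Qed.

End Grassmannian.

Arguments hyperplane F n : clear implicits.
Arguments torus' F n : clear implicits.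
Arguments thin_cell F {n} M.
Arguments qtorus' F {n} M.
Arguments qtorus F {n} M.
Arguments cell_quotient F {n} M.
Arguments cell_hyp_quotient F {n} M.

(* Main.v *)
Require Import Defs.
From mathcomp Require Import all_boot all_order all_algebra.
From mathcomp Require Import boolp classical_sets functions reals complex.
Local Open Scope classical_set_scope.

(** The map [pi] sends the [T]-orbit of a point of [G_M `&` H] to its
    [T']-orbit. It is well defined because [T] is contained in [T'], and it is
    a morphism by the universal property of the quotient: the composite of the
    inclusion of [G_M `&` H] in [G_M] with the quotient map [G_M -> G_M / T'_M]
    is one, open sets and regular functions being stable under restriction
    ([zopen_restrict], [zregular_restrict]), and it is constant on [T]-orbits.

    Surjectivity says that every [T']-orbit in [G_M] meets [H]
    ([torus'_meets_hyperplane]). Let [y] be a point of [G_M `&` H] and [x] one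
    of [G_M]. Their Plücker coordinates vanish at the same places, so that the
    ratios [t_i = y_{i,i'} / x_{i,i'}], where [i' = rev_ord i], replaced by [1]
    where [x_{i,i'} = 0], are nonzero. The diagonal matrix with entry [t_i] at
    [i < i'] and [1] at [i'] multiplies [x_{i,i'}] by [t_i], so that it moves
    [x] to a point whose coordinates of index [i,i'] are, up to a common
    factor, those of [y]; as the equation of [H] involves only these, this
    point is in [H].

    The fiber is computed from the facts that [T'] preserves [G_M]
    ([thin_cell_tact]) and that two points with the same [T']-orbit differ by
    an element of [T']. *)

Set Implicit Arguments.
Unset Strict Implicit.
Unset Printing Implicit Defensive.

Section Restriction.
Import GRing.Theory.
Local Open Scope ring_scope.
Variables (F : fieldType) (m : nat).
Implicit Types X Y U : set {vspace 'rV[F]_m}.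

Lemma zopen_restrict X Y U : Y `<=` X -> zopen X U -> zopen Y (Y `&` U).
Proof.
move=> YX [S [hS ->]]; exists S; split=> //.
by rewrite setIA (setIidl YX).
Qed.

Lemma zregular_restrict X Y U f :
  Y `<=` X -> zregular X U f -> zregular Y (Y `&` U) f.
Proof.
move=> YX rf x [Yx Ux].
have [V [oV VU Vx [d [p [q [hp hq pq]]]]]] := rf x Ux.
exists (Y `&` V); split=> //.
- exact: zopen_restrict oV.
- exact: setIS.
- by exists d, p, q; split=> // y [_ Vy]; apply: pq.
Qed.

(** The homogeneous coordinates chosen on a line are proportional to those of
    any vector spanning it; a degenerate line [v = 0] does no harm. *)
Lemma hcoord_line (v : 'rV[F]_m) :
  exists2 c, c != 0 & forall k, hcoord <[v]>%VS k = c * v ord0 k.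
Proof.
have /vlineP [c cE] := memv_pick <[v]>%VS.
have [v0|v0] := eqVneq v 0.
  exists 1; rewrite ?oner_eq0 // => k.
  by rewrite /hcoord cE v0 scaler0 !mxE mulr0.
exists c => [|k]; last by rewrite /hcoord cE mxE.
apply: contra_neq v0 => c0; apply/eqP.
move/eqP: cE; rewrite c0 scale0r vpick0 => /eqP ve.
by have := memv_line v; rewrite ve memv0.
Qed.

End Restriction.

Section Orbits.
Import GRing.Theory.
Local Open Scope ring_scope.
Variables (F : fieldType) (n : nat).
Local Notation m := #|{: plpair n}|.
Local Notation point := {vspace 'rV[F]_m}.
Implicit Types (M : matroid 'I_(2 * n)) (x y : point).

Lemma torus'V D : torus' F n D -> torus' F n (invmx D).
Proof.
move=> D'; have uD := D'.2; have /torus'E [d dE d0] := D'.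
apply/torus'E; exists (\row_i (d ord0 i)^-1); last by move=> i; rewrite mxE invr_eq0.
apply: (can_inj (mulKmx uD)); rewrite mulmxV // {1}dE mulmx_diag.
rewrite -diag_const_mx; congr diag_mx; apply/rowP=> i.
by rewrite !mxE mulfV.
Qed.

Lemma tactK D x : torus' F n D -> tact (invmx D) (tact D x) = x.
Proof.
move=> D'; rewrite -tactM //; last exact: torus'V.
by rewrite mulVmx ?tact1 //; exact: D'.2.
Qed.

Lemma orbit_qtorus'_tact M D x : torus' F n D ->
  torus_orbit (qtorus' F M) (tact D x) = torus_orbit (qtorus' F M) x.
Proof.
move=> D'; rewrite !orbit_qtorus'; apply/seteqP; split=> _ [E E' <-].
  by exists (E *m D); [exact: torus'M | rewrite tactM].
exists (E *m invmx D); first by apply: torus'M => //; exact: torus'V.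
by rewrite tactM ?tactK //; exact: torus'V.
Qed.

Lemma orbit_qtorus'_refl M x : torus_orbit (qtorus' F M) x x.
Proof. by rewrite orbit_qtorus'; exists 1%:M; [exact: torus'1 | exact: tact1]. Qed.

Lemma orbit_qtorus_refl M x : torus_orbit (qtorus F M) x x.
Proof. by rewrite orbit_qtorus; exists 1%:M; [exact: torus1 | exact: tact1]. Qed.

Lemma orbit_qtorus_qtorus' M x y :
  torus_orbit (qtorus F M) x = torus_orbit (qtorus F M) y ->
  torus_orbit (qtorus' F M) x = torus_orbit (qtorus' F M) y.
Proof.
move=> exy; have := orbit_qtorus_refl M y.
rewrite -exy orbit_qtorus => -[D [D' _] <-].
by rewrite orbit_qtorus'_tact.
Qed.

(** Up to a common nonzero factor, which the choice of homogeneous coordinates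
    introduces, [D] multiplies the coordinate [x_{i,j}] by [D_i D_j]. *)
Lemma plcoord_tact D x : \dim x = 1%N ->
  exists2 c, c != 0 & forall p : plpair n,
    plcoord (tact D x) p =
      c * (D (val p).1 (val p).1 * D (val p).2 (val p).2 * plcoord x p).
Proof.
move=> dx.
have xE : x = <[vpick x]>%VS.
  apply/eqP; rewrite eq_sym eqEdim -memvE memv_pick dx dim_vline vpick0.
  by rewrite -dimv_eq0 dx.
have [c c0 hc] := hcoord_line (vpick x *m diag_mx (weight D)).
exists c => // p; rewrite /plcoord {1}xE tact_line hc mul_mx_diag !mxE enum_rankK.
by case: (val p) => i j /=; rewrite mulrC [in RHS]mulrC [in RHS](mulrC (D i i * _)).
Qed.

Lemma pluecker_mul_torus (A : 'M[F]_(2, 2 * n)) D : torus' F n D ->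
  pluecker (A *m D) = pluecker A *m diag_mx (weight D).
Proof.
move=> /torus'E [d -> _]; apply/rowP=> k.
rewrite !mul_mx_diag !mxE; case: (val (enum_val k)) => i j.
by rewrite !mxE !eqxx !mulr1n mulrBl; congr (_ - _); rewrite mulrACA // [d _ j * _]mulrC.
Qed.

Lemma plpair_set_inj :
  injective (fun p : plpair n => [set (val p).1; (val p).2]%SET).
Proof.
move=> [[i j] /= ij] [[k l] /= kl] /setP e; apply: val_inj => /=.
have := (e i, e j); rewrite !inE !eqxx /= orbT => -[].
move=> /esym/orP [] /eqP ? /esym/orP [] /eqP ?; subst=> //;
  rewrite ?ltnn // in ij kl *.
by have := ltn_trans ij kl; rewrite ltnn.
Qed.

(** All points of [G_M] have the same nonzero coordinates. *)
Lemma thin_cell_plcoord M x p : thin_cell F M x ->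
  (plcoord x p != 0) = ([set (val p).1; (val p).2]%SET \in bases M).
Proof. by move=> [_ <-]; rewrite (finset.mem_imset _ _ plpair_set_inj) inE. Qed.

Lemma thin_cell_projspace M x : thin_cell F M x -> @projspace F m x.
Proof.
move=> [[A _ xE] Bx]; rewrite /projspace /= xE dim_vline.
have /set0Pn [b] := bases_neq0 M; rewrite -Bx => /imsetP [p].
rewrite inE xE /plcoord; have [c _ ->] := hcoord_line (pluecker A).
by case: (eqVneq (pluecker A) 0) => [->|//]; rewrite mxE mulr0 eqxx.
Qed.

Lemma torus'_neq0 D i : torus' F n D -> D i i != 0.
Proof. by move=> /torus'E [d -> d0]; rewrite mxE eqxx mulr1n. Qed.

Lemma thin_cell_tact M D x :
  torus' F n D -> thin_cell F M x -> thin_cell F M (tact D x).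
Proof.
move=> D' Mx; have dx := thin_cell_projspace Mx.
case: Mx => -[A rA xE] Bx; split.
  exists (A *m D); last by rewrite xE tact_line pluecker_mul_torus.
  by rewrite mxrankMfree // row_free_unit; exact: D'.2.
have [c c0 hc] := plcoord_tact D dx.
have tx0 p : (plcoord (tact D x) p != 0) = (plcoord x p != 0).
  by rewrite hc !mulf_eq0 !negb_or c0 !torus'_neq0.
rewrite /= -Bx; apply/setP=> b.
by apply/imsetP/imsetP => -[p]; rewrite inE => xp ->; exists p;
  rewrite // inE ?tx0 // -tx0.
Qed.

Lemma torus'_meets_hyperplane M x y :
    thin_cell F M x -> thin_cell F M y -> hyperplane F n y ->
  exists2 D, torus' F n D & hyperplane F n (tact D x).
Proof.
move=> Mx My [_ yH].
pose t (p : plpair n) := if plcoord x p == 0 then 1 else plcoord y p / plcoord x p.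
(* Only pairs [i < rev_ord i] index coordinates, hence the entry 1 at the
   second element of each pair. *)
pose d := \row_i if insub (i, rev_ord i) is Some p then t p else 1.
have xy0 p : (plcoord x p == 0) = (plcoord y p == 0).
  by apply: negb_inj; rewrite !(thin_cell_plcoord p (M := M)).
have d0 i : d ord0 i != 0.
  rewrite mxE; case: insubP => [p _ _|_]; last exact: oner_neq0.
  rewrite /t; have [_|x0] := eqVneq (plcoord x p) 0; first exact: oner_neq0.
  by rewrite mulf_neq0 ?invr_eq0 // -xy0.
have D' : torus' F n (diag_mx d) by apply/torus'E; exists d.
exists (diag_mx d) => //; split.
  exact: thin_cell_projspace (thin_cell_tact D' Mx).
have [c _ hc] := plcoord_tact (diag_mx d) (thin_cell_projspace Mx).
rewrite /= in yH *.
(* The equation of [H] at [tact D x] is [c] times the one at [y]. *)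
rewrite -[RHS](mulr0 c) -[in RHS]yH mulr_sumr; apply: eq_bigr => p /eqP p2.
rewrite hc; congr (c * _); rewrite !mxE !eqxx !mulr1n.
rewrite p2 rev_ordK -p2 -surjective_pairing valK.
rewrite insubN ?mulr1 /=; last by rewrite -leqNgt ltnW ?(valP p).
rewrite /t; case: eqP => [x0|/eqP x0]; last by rewrite divfK.
by rewrite x0 mulr0; apply/esym/eqP; rewrite -xy0 x0.
Qed.

(** The inclusion of [G_M `&` H] in [G_M], followed by the quotient map
    [G_M -> G_M / T'_M]. *)
Lemma thin_cell_inclusion_morphism M :
  space_morphism (variety (thin_cell F M `&` hyperplane F n))
                 (cell_quotient F M) (torus_orbit (qtorus' F M)).
Proof.
have HG : thin_cell F M `&` hyperplane F n `<=` thin_cell F M by move=> ? [].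
have preE U : thin_cell F M `&` hyperplane F n `&` torus_orbit (qtorus' F M) @^-1` U
    = thin_cell F M `&` hyperplane F n
      `&` (thin_cell F M `&` torus_orbit (qtorus' F M) @^-1` U).
  by rewrite setIA (setIidl HG).
split=> [x [Mx _]|U [_ oU]|U f [_ oU] rf] /=.
- by exists x.
- by rewrite preE; exact: zopen_restrict oU.
- by rewrite preE; exact: zregular_restrict rf.
Qed.

(** Nothing here depends on the base field: the equation of [H] is solved by
    copying a given solution, not by choosing generic parameters. *)
Lemma cell_hyp_quotient_map M :
    thin_cell F M `&` hyperplane F n !=set0 ->
  exists pi : set point -> set point,
    [/\ space_morphism (cell_hyp_quotient F M) (cell_quotient F M) pi,
        set_surj (pts (cell_hyp_quotient F M)) (pts (cell_quotient F M)) pi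
      & forall x, thin_cell F M x ->
          pts (cell_hyp_quotient F M)
            `&` pi @^-1` [set torus_orbit (qtorus' F M) x]
          = torus_orbit (qtorus F M) @`
              ([set tact D x | D in torus' F n] `&` hyperplane F n)].
Proof.
move=> [y [My yH]].
have [||pi [pim piE _]] := quotient_universal (orb := torus_orbit (qtorus F M)) _ _
    (thin_cell_inclusion_morphism M).
- by move=> U [].
- by move=> x z _ _; exact: orbit_qtorus_qtorus'.
exists pi; split=> // [_ [x Mx <-]|x Mx].
  have [D D' xH] := torus'_meets_hyperplane Mx My yH.
  have MDx := thin_cell_tact D' Mx.
  exists (torus_orbit (qtorus F M) (tact D x)); first by exists (tact D x).
  by rewrite piE // orbit_qtorus'_tact.
apply/seteqP; split=> [_ [[z [Mz zH] <-]]|_ [_ [[D D' <-] xH] <-]] /=.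
  rewrite piE // => zx; exists z => //; split=> //.
  by have := orbit_qtorus'_refl M z; rewrite zx orbit_qtorus'.
have MDx := thin_cell_tact D' Mx.
split; first by exists (tact D x).
by rewrite piE // orbit_qtorus'_tact.
Qed.

End Orbits.

Theorem proposition3p13 (R : realType) (n : nat) (hn : (2 <= n)%N)
    (M : matroid 'I_(2 * n)) (hM : has_rank M 2)
    (hne : thin_cell (complex R) M `&` hyperplane (complex R) n !=set0) :
  exists pi : set {vspace 'rV[complex R]_#|{: plpair n}|} ->
              set {vspace 'rV[complex R]_#|{: plpair n}|},
    [/\ space_morphism (cell_hyp_quotient (complex R) M)
                       (cell_quotient (complex R) M) pi,
        set_surj (pts (cell_hyp_quotient (complex R) M))
                 (pts (cell_quotient (complex R) M)) pi
      & forall x, thin_cell (complex R) M x ->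
          pts (cell_hyp_quotient (complex R) M)
            `&` pi @^-1` [set torus_orbit (qtorus' (complex R) M) x]
          = torus_orbit (qtorus (complex R) M) @`
              ([set tact D x | D in torus' (complex R) n]
                 `&` hyperplane (complex R) n)].
Proof. exact: cell_hyp_quotient_map. Qed.
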